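(* In the ring $\mathbb{M}_{2}(\mathbb{Z})$ the following hold. (i) Stable range 1 elements do not have the complementary property; that is, it is not true that for every $A\in\mathbb{M}_2(\mathbb{Z})$ having stable range 1 the matrix $I_2-A$ has stable range 1. (ii) For all $A,B\in\mathbb{M}_2(\mathbb{Z})$, $AB$ has stable range 1 if and only if $BA$ has stable range 1. (iii) Jacobson's Lemma holds for stable range 1 matrices: for all $A,B\in\mathbb{M}_2(\mathbb{Z})$, $I_2-AB$ has stable range 1 if and only if $I_2-BA$ has stable range 1.
   Context: $\mathbb{M}_2(\mathbb{Z})$ is the ring of $2\times 2$ integer matrices and $I_2$ its identity. Let $S$ be a unital ring with group of units $U(S)$. An element $a\in S$ has left stable range 1 if whenever $Sa+Sb=S$ for some $b\in S$, there is $y\in S$ with $a+yb\in U(S)$; it has right stable range 1 if whenever $aS+bS=S$ for some $b\in S$, there is $y\in S$ with $a+by\in U(S)$; it has stable range 1 if it has both left and right stable range 1. *)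

(* Defs.v *)
From mathcomp Require Import all_boot all_order all_algebra.

Set Implicit Arguments.
Unset Strict Implicit.
Unset Printing Implicit Defensive.

Import GRing.Theory.
Local Open Scope ring_scope.

(* Sa + Sb = S, resp. aS + bS = S: only the inclusion of S in the sum is
   written out, the other one being automatic. *)
Definition left_unimodular (S : unitRingType) (a b : S) : Prop :=
  forall s : S, exists x y : S, x * a + y * b = s.

Definition right_unimodular (S : unitRingType) (a b : S) : Prop :=
  forall s : S, exists x y : S, a * x + b * y = s.

(* In a unitRingType, [GRing.unit] is the group of two-sided units. *)
Definition left_sr1 (S : unitRingType) (a : S) : Prop :=
  forall b : S, left_unimodular a b ->
    exists y : S, a + y * b \is a GRing.unit.

Definition right_sr1 (S : unitRingType) (a : S) : Prop :=
  forall b : S, right_unimodular a b ->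
    exists y : S, a + b * y \is a GRing.unit.

Definition sr1 (S : unitRingType) (a : S) : Prop :=
  left_sr1 a /\ right_sr1 a.

(* Main.v *)
Require Import Defs.
From mathcomp Require Import all_boot all_order all_algebra.
From mathcomp Require Import ring zify.

Import Order.TTheory GRing.Theory.
Local Open Scope ring_scope.

(** All three claims follow from one characterization: a matrix [A] over the
    integers has stable range 1 iff its determinant is -1, 0 or 1
    ([sr1_mx2int]).  Since [A * B] and [B * A] have the same determinant, and so
    have [1 - A * B] and [1 - B * A] (Sylvester's identity), (ii) and (iii) are
    immediate; and diag(3, 0) has determinant 0 whereas 1 - diag(3, 0) has
    determinant -2, which gives (i).

    If [\det A] is 1 or -1, then [A] is itself a unit.  If [\det A = 0], the
    Smith normal form reduces [A] to diag(d, 0), because left stable range 1 is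
    unchanged by unit factors; over any commutative ring, an explicit
    completion shows that diag(d, 0) has left stable range 1
    ([left_sr1_corner]).  The right-hand condition is the left-hand one for the
    transpose.

    Conversely, let [n = \det A] and [b = n ^+ 2 + 1].  As [n] and [b] are
    coprime, [A] is invertible modulo [b], so [A] and the scalar matrix [b] are
    left unimodular; but [A + Y * b] has determinant [n] modulo [b], and when
    [`|n| > 1] the modulus is too large for [n] to be congruent to 1 or -1
    ([left_sr1_det_le1]). *)

Lemma left_sr1_unitM (S : unitRingType) (u a v : S) :
    u \is a GRing.unit -> v \is a GRing.unit ->
  left_sr1 a -> left_sr1 (u * a * v).
Proof.
move=> uU vU sr_a b uab; have [x [y xyb]] := uab 1.
have /sr_a[z az_unit] : left_unimodular a (b * v^-1).
  move=> s; exists (s * v * x * u), (s * v * y).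
  have -> : s * v * x * u * a + s * v * y * (b * v^-1)
          = s * v * (x * (u * a * v) + y * b) * v^-1.
    by rewrite mulrDr mulrDl !mulrA mulrK.
  by rewrite xyb mulr1 mulrK.
exists (u * z).
have -> : u * a * v + u * z * b = u * (a + z * (b * v^-1)) * v.
  by rewrite mulrDr mulrDl !mulrA mulrVK.
by rewrite unitrMl // unitrMr.
Qed.

Section TwoByTwo.

Variable R : comUnitRingType.
Implicit Types A B : 'M[R]_2.

Lemma ord2E : (lift ord0 (ord0 : 'I_1) = 1 :> 'I_2) * (ord0 = 0 :> 'I_2).
Proof. by split; apply: val_inj. Qed.

Lemma det_mx2E A : \det A = A 0 0 * A 1 1 - A 0 1 * A 1 0.
Proof.
rewrite (expand_det_row _ 0) !big_ord_recl big_ord0 /cofactor !det_mx11 !mxE /=.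
have [-> ->] : lift (lift ord0 ord0) ord0 = 0 :> 'I_2 /\ lift 0 0 = 1 :> 'I_2.
  by split; apply: val_inj.
by rewrite expr0 expr1; ring.
Qed.

Lemma mulmx2E A B i j : (A * B) i j = A i 0 * B 0 j + A i 1 * B 1 j.
Proof. by rewrite mxE !big_ord_recl big_ord0 addr0 !ord2E. Qed.

(** Sylvester's identity. *)
Lemma det_1subC A B : \det (1 - A * B) = \det (1 - B * A).
Proof. by rewrite !det_mx2E !mxE !big_ord_recl !big_ord0 !ord2E /=; ring. Qed.

(** Write [D] as diag(d, 0), let [x * D + y * B = 1] and [k = \det B].  The
    second column of that equation says that the second row of [y] is a Bezout
    relation for the second column of [B].  Hence the matrix [U] of determinant
    1 with rows [(B 1 1, - B 0 1)] and [(y 1 0, y 1 1)] makes [U * B] lower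
    triangular, with rows [(k, 0)] and [(m, 1)].  Taking determinants in
    [y * B = 1 - x * D] yields [x 0 0 * d + \det y * k = 1], and then
    [D + V * (U * B)] has determinant 1 for the matrix [V] with rows [(0, -1)]
    and [(\det y, x 0 0)]. *)
Lemma left_sr1_corner (D : 'M[R]_2) :
  D 0 1 = 0 -> D 1 0 = 0 -> D 1 1 = 0 -> left_sr1 D.
Proof.
move=> D01 D10 D11 B /(_ 1)[x [y xy1]].
have e11 : y 1 0 * B 0 1 + y 1 1 * B 1 1 = 1.
  have := congr1 (fun M : 'M_2 => M 1 1) xy1.
  by rewrite mxE !mulmx2E D01 D11 !mulr0 !add0r mxE.
have bezout : x 0 0 * D 0 0 + \det y * \det B = 1.
  rewrite -det_mulmx; have -> : y *m B = 1 - x * D.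
    by rewrite -xy1 addrAC subrr add0r.
  rewrite det_mx2E !mxE !big_ord_recl !big_ord0 !ord2E /=.
  by rewrite D01 D10 D11; ring.
(* This is the product [V * U]. *)
pose Y : 'M[R]_2 := \matrix_(i, j)
  if i == 0 then - y 1 j
  else \det y * (if j == 0 then B 1 1 else - B 0 1) + x 0 0 * y 1 j.
exists Y; rewrite unitmxE; suff -> : \det (D + Y * B) = 1 by exact: unitr1.
rewrite det_mx2E ![(D + _) _ _]mxE !mulmx2E !mxE /= D01 D10 D11.
(* The determinant is the left side of [e11] times that of [bezout]. *)
rewrite -bezout (det_mx2E B).
by rewrite -[RHS]mul1r -e11; ring.
Qed.

End TwoByTwo.

(** In the Smith form diag(d0, d1), the divisibility [d0 %| d1] turns
    [d0 * d1 = 0] into [d1 = 0]. *)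
Lemma left_sr1_det0 (A : 'M[int]_2) : \det A = 0 -> left_sr1 A.
Proof.
have [L Lu [V Vu [d d_sorted ->]]] := int_Smith_normal_form A.
rewrite !det_mulmx => /eqP; rewrite !mulf_eq0.
have unit_det0F (M : 'M[int]_2) : M \in unitmx -> (\det M == 0) = false.
  by rewrite unitmxE; apply: contraTF => /eqP->; rewrite unitr0.
rewrite (unit_det0F L) // (unit_det0F V) // orbF /= => det0.
apply: left_sr1_unitM => //; apply: left_sr1_corner; rewrite mxE //=.
move: det0; rewrite det_mx2E !mxE /= mulr0 subr0 mulf_eq0.
case: d d_sorted => [|d0 [|d1 d]] //= /andP[d0d1 _] /orP[] /eqP //.
by rewrite mulr1n => d00; have /dvdzP[q ->] := d0d1; rewrite d00 mulr0.
Qed.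

Lemma right_sr1_tr (R : comUnitRingType) n (A : 'M[R]_n.+1) :
  left_sr1 A^T -> right_sr1 A.
Proof.
move=> sr_A B AB; have /sr_A[y yU] : left_unimodular A^T B^T.
  move=> s; have [x [y xyE]] := AB s^T.
  exists x^T, y^T; apply: trmx_inj; rewrite linearD /=.
  by rewrite [(x^T * _)^T]trmx_mul [(y^T * _)^T]trmx_mul !trmxK.
exists y^T; rewrite -[_ \is a _]unitmx_tr.
by rewrite linearD /= [(B * _)^T]trmx_mul trmxK.
Qed.

(** The scalar matrix of [n ^+ 2 + 1] is a witness for all determinants [n] at
    once: this integer is coprime to [n], and exceeds [`|n| + 1] when
    [`|n| > 1], so that it divides neither [n - 1] nor [n + 1]. *)
Lemma left_sr1_det_le1 (A : 'M[int]_2) : left_sr1 A -> `|\det A| <= 1.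
Proof.
move=> sr_A; set n := \det A; pose b := n ^+ 2 + 1.
have /sr_A[Y] : left_unimodular A b%:M.
  (* From [\adj A * A = n%:M] and [- n * n + b = 1]. *)
  move=> s; exists (- n *: (s * \adj A)), s.
  rewrite -scalerAl -mulrA [_ * A]mul_adj_mx -/n.
  rewrite [s * n%:M]mul_mx_scalar [s * b%:M]mul_mx_scalar scalerA -scalerDl.
  by rewrite (_ : _ + b = 1) ?scale1r // /b; ring.
have [z detE] : exists z, \det (A + Y * b%:M) = n + b * z.
  exists (A 0 0 * Y 1 1 + A 1 1 * Y 0 0 - A 0 1 * Y 1 0 - A 1 0 * Y 0 1
          + b * \det Y).
  rewrite [Y * _]mul_mx_scalar /n !det_mx2E !mxE; ring.
rewrite unitmxE detE qualifE /=.
rewrite {detE}/b; move: n => n unit_n.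
have [z_lt0|z_gt0|z0] := ltgtP z 0; nia.
Qed.

Lemma sr1_mx2int (A : 'M[int]_2) : sr1 A <-> `|\det A| <= 1.
Proof.
split=> [[/left_sr1_det_le1 //]|detA_le1].
have left_sr1A (M : 'M[int]_2) : `|\det M| <= 1 -> left_sr1 M.
  move=> detM_le1; have [/left_sr1_det0 //|detM_neq0] := eqVneq (\det M) 0.
  move=> B _; exists 0; rewrite mul0r addr0 unitmxE.
  rewrite qualifE /=; move: (\det M) detM_le1 detM_neq0 => n; lia.
by split; [|apply: right_sr1_tr]; apply: left_sr1A; rewrite ?det_tr.
Qed.

Theorem corollary13 :
  [/\ ~ (forall A : 'M[int]_2, sr1 A -> sr1 (1 - A)),
      (forall A B : 'M[int]_2, sr1 (A * B) <-> sr1 (B * A))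
    & (forall A B : 'M[int]_2, sr1 (1 - A * B) <-> sr1 (1 - B * A))].
Proof.
split=> [compl | A B | A B].
- pose A : 'M[int]_2 := \matrix_(i, j) (3 *+ ((i == 0) && (j == 0))).
  have /compl/sr1_mx2int : sr1 A by apply/sr1_mx2int; rewrite det_mx2E !mxE.
  by rewrite det_mx2E !mxE.
- by rewrite !sr1_mx2int [\det (A * B)]det_mulmx mulrC -det_mulmx.
- by rewrite !sr1_mx2int det_1subC.
Qed.
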